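(* Let $f$ be a strongly biased random multiplicative function. If for some fixed $0<\alpha<1/2$ we have $M_f(x)=o(x^{1-\alpha})$ almost surely, then almost surely the series $\sum_{p\in\mathcal{P}}\frac{1+f(p)}{p^{1-\alpha+\epsilon}}$ converges for every $\epsilon>0$.
   Context: $\mathcal{P}$ denotes the set of primes and $\mu$ the Möbius function. A random multiplicative function is a random function $f:\mathbb{N}\times\Omega\to\{-1,0,1\}$ with $f(1)=1$, $f(n)=|\mu(n)|\prod_{p\mid n}f(p)$ for $n\ge2$, where $\{f(p)\}_{p\in\mathcal{P}}$ are independent $\pm1$-valued random variables. $f$ is biased if $\mathbb{E} f(p)<0$ for all primes $p$; it is strongly biased if it is biased and $\sum_{p\in\mathcal{P}} f(p)/p=-\infty$ almost surely. $M_f(x):=\sum_{n\le x}f(n)$. *)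

(* Defs.v *)
From HB Require Import structures.
From mathcomp Require Import all_boot all_order all_algebra.
From mathcomp Require Import all_classical all_reals all_analysis.

Set Implicit Arguments.
Unset Strict Implicit.
Unset Printing Implicit Defensive.

Import Order.TTheory GRing.Theory Num.Theory.
Import numFieldNormedType.Exports.

Local Open Scope classical_set_scope.
Local Open Scope ring_scope.

(* Registers the filter +oo so that the little-o notation _ =o_ +oo _ applies. *)
Canonical pinfty_filter_on (R : numFieldType) : filter_on R :=
  FilterType (pinfty_nbhs R) (@filter_filter R _ proper_pinfty_nbhs).

(* Only meant for n >= 1. *)
Definition moebius (n : nat) : int :=
  if has (fun p => p ^ 2 %| n)%N (primes n) then 0
  else (-1) ^+ size (primes n).

(* Mutual independence of the subfamily of X indexed by D: the product rule
   over every finite subfamily. *)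
Definition independent_RVs d (T : measurableType d) (R : realType)
    (P : probability T R) (I : choiceType) (D : set I)
    (X : I -> {RV P >-> R}) : Prop :=
  forall (s : seq I) (B : I -> set R),
    uniq s -> [set` s] `<=` D -> (forall i, measurable (B i)) ->
    P (\bigcap_(i in [set` s]) (X i @^-1` B i)) =
    (\big[*%E/1%E]_(i <- s) P (X i @^-1` B i))%E.

(* The positive integers are the arguments of interest: f 0 is left
   unconstrained (it is only required to be a random variable) and is never
   used. *)
Record random_multiplicative d (T : measurableType d) (R : realType)
    (P : probability T R) (f : nat -> {RV P >-> R}) : Prop := {
  rmf_prime : forall p w, prime p -> f p w = 1 \/ f p w = -1 ;
  rmf_indep : independent_RVs [set p | prime p] f ;
  rmf_one : forall w, f 1%N w = 1 ;
  rmf_mul : forall n w, (2 <= n)%N ->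
    f n w = `|moebius n|%:~R * \prod_(p <- primes n) f p w }.

Definition biased d (T : measurableType d) (R : realType)
    (P : probability T R) (f : nat -> {RV P >-> R}) : Prop :=
  forall p, prime p -> ('E_P[f p] < 0)%E.

Definition strongly_biased d (T : measurableType d) (R : realType)
    (P : probability T R) (f : nat -> {RV P >-> R}) : Prop :=
  biased f /\
  {ae P, forall w,
    (\sum_(0 <= p < N | prime p) f p w / p%:R) @[N --> \oo] --> -oo}.

(* M_f(x), for real x; Num.truncn x is the floor of x when x >= 0. *)
Definition summatory d (T : measurableType d) (R : realType)
    (P : probability T R) (f : nat -> {RV P >-> R}) (w : T) (x : R) : R :=
  \sum_(1 <= n < (Num.truncn x).+1) f n w.

(* Main.v *)
Require Import Defs.
From HB Require Import structures.
From mathcomp Require Import all_boot all_order all_algebra.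
From mathcomp Require Import all_classical all_reals all_analysis.
From mathcomp Require Import ring lra zify.
Import Order.TTheory GRing.Theory Num.Theory.
Import numFieldNormedType.Exports.
Local Open Scope classical_set_scope.
Local Open Scope ring_scope.
Set Implicit Arguments.
Unset Strict Implicit.
Unset Printing Implicit Defensive.

(* The statement holds pointwise.  Fix an outcome and let a = 1 * f be the
   Dirichlet convolution; a(n) = prod_(p | n) (1 + f p) is nonnegative and
   a(p) = 1 + f p, so it suffices to bound A(x) = sum_(n <= x) a(n) by
   O(x^(1 - alpha)) and sum by parts.  Write L(x) = sum_(d <= x) f(d) / d.
   By partial summation the bound on M_f makes L converge with error
   O(x^(-alpha)), and its limit is not positive: otherwise the Dirichlet series
   of f would stay away from 0 at s = 1 + delta as delta -> 0, whereas its Euler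
   product is at most exp(sum_p f(p) p^(-s)), which tends to 0.  Hence
   L(x) <= O(x^(-alpha)).  Finally
     sum_(n < X) A(n) = sum_(d <= X) f(d) sum_(n < X) floor(n / d)
                      = (X^2 L(X) - X M_f(X) + sum_(d <= X) f(d) gap(d)) / 2
   with |gap(d) - gap(d + 1)| = O(X / d), so partial summation gives
   sum_(n < X) A(n) = O(X^(2 - alpha)), and A is nondecreasing. *)

(** * Summation by parts *)

Lemma sum_by_parts (R : comNzRingType) (u g : nat -> R) (m n : nat) : (m <= n)%N ->
  \sum_(m <= d < n.+1) u d * g d =
  \sum_(m <= d < n) (\sum_(m <= i < d.+1) u i) * (g d - g d.+1) +
  (\sum_(m <= d < n.+1) u d) * g n.
Proof.
elim: n => [|n IH] mn.
  by move: mn; rewrite leqn0 => /eqP ->; rewrite !big_nat1 big_geq // add0r.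
move: mn; rewrite leq_eqVlt => /predU1P[->|mn].
  by rewrite !big_nat1 big_geq // add0r.
rewrite big_nat_recr ?IH //=; last exact: leqW.
rewrite [\sum_(m <= d < n.+1) _ * (_ - _)]big_nat_recr //=.
rewrite [\sum_(m <= d < n.+2) _]big_nat_recr /=; last exact: leqW.
ring.
Qed.

(** Summation by parts writes both sides as combinations of partial sums, with the decrements of [w]
    and its last value as coefficients; all of these are nonnegative. *)
Lemma ler_sum_by_parts (R : realFieldType) (u v w : nat -> R) (m n : nat) :
  (forall k, (m <= k < n)%N ->
     \sum_(m <= i < k.+1) u i <= \sum_(m <= i < k.+1) v i) ->
  (forall k, (m <= k)%N -> 0 <= w k) ->
  (forall k, (m <= k)%N -> w k.+1 <= w k) ->
  \sum_(m <= i < n) u i * w i <= \sum_(m <= i < n) v i * w i.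
Proof.
case: n => [|n] uv w0 wd; first by rewrite !big_geq.
have [mn|nm] := leqP m n; last by rewrite !big_geq.
rewrite !sum_by_parts //; apply: lerD.
  rewrite !big_nat; apply: ler_sum => k /andP[mk kn].
  by apply: ler_wpM2r; [rewrite subr_ge0 wd|apply: uv; rewrite mk ltnW].
by apply: ler_wpM2r; [exact: w0|apply: uv; rewrite mn /=].
Qed.

(** * Sums of negative powers of integers *)

Section powers.
Variable R : realType.
Implicit Types (a s del : R) (n : nat).

(** A discrete form of comparing t^(-1-del) with its integral over [n, n+1]; it follows from ln (1 -
    1/x) <= -1/x and exp t >= 1 + t. *)
Lemma powR_le_telescope del n : 0 < del -> (0 < n)%N ->
  n.+1%:R `^ (- 1 - del) <= (n%:R `^ (- del) - n.+1%:R `^ (- del)) / del.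
Proof.
move=> d0 n0; set x : R := n.+1%:R; set y : R := n%:R.
have y0 : 0 < y by rewrite ltr0n.
have xE : x = y + 1 by rewrite /x -natr1.
have x0 : 0 < x by rewrite xE; lra.
have -> : x `^ (- 1 - del) = x^-1 * x `^ (- del).
  by rewrite powRD ?(gt_eqF x0) ?implybT// powR_inv1 // ltW.
rewrite ler_pdivlMr //.
have -> : y `^ (- del) = x `^ (- del) * expR (- del * ln (y / x)).
  rewrite /powR !gt_eqF // -expRD ln_div ?posrE //.
  by congr expR; ring.
have l : ln (y / x) <= - x^-1.
  have -> : y / x = 1 + - x^-1 by rewrite xE; field; lra.
  apply: le_ln1Dx.
  by rewrite ltrN2 invf_lt1 // xE; lra.
have e : 1 + del * x^-1 <= expR (- del * ln (y / x)).
  apply: le_trans (expR_ge1Dx _).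
  by rewrite lerD2l mulNr -mulrN ler_pM2l // lerNr.
rewrite -[X in _ <= _ - X]mulr1 -mulrBr mulrAC mulrC.
by rewrite ler_wpM2l ?powR_ge0 // lerBrDl [_ * del]mulrC.
Qed.

Lemma sum_powR_telescope del m n : 0 < del -> (0 < m <= n)%N ->
  \sum_(m.+1 <= d < n.+1) d%:R `^ (- 1 - del) <= m%:R `^ (- del) / del :> R.
Proof.
move=> d0 /andP[m0 mn].
apply: (@le_trans _ _ ((m%:R `^ (- del) - n%:R `^ (- del)) / del)).
  rewrite big_add1 /= -[m%:R `^ _ - _]opprB.
  rewrite -(telescope_sumr (fun i => i%:R `^ (- del))) // mulNr mulr_suml -sumrN.
  rewrite !big_nat; apply: ler_sum => i /andP[mi _].
  rewrite -mulNr opprB; apply: powR_le_telescope => //.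
  exact: leq_trans mi.
rewrite ler_pM2r ?invr_gt0 // gerBl; exact: powR_ge0.
Qed.

Lemma ler_powRN_nat s m n : 0 <= s -> (0 < m <= n)%N ->
  n%:R `^ (- s) <= m%:R `^ (- s) :> R.
Proof.
move=> s0 /andP[m0 mn]; rewrite !powRN lef_pV2 ?posrE ?powR_gt0 ?ltr0n //.
  by apply: ge0_ler_powR; rewrite ?nnegrE ?ler0n ?ler_nat.
exact: leq_trans mn.
Qed.

Lemma powRN_le_sum a n : 0 <= a ->
  n%:R * n%:R `^ (- a) <= \sum_(1 <= d < n.+1) d%:R `^ (- a) :> R.
Proof.
move=> a0; apply: (@le_trans _ _ (\sum_(1 <= d < n.+1) n%:R `^ (- a))).
  by rewrite sumr_const_nat subn1 /= mulr_natl.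
by rewrite !big_nat; apply: ler_sum => d dn; apply: ler_powRN_nat.
Qed.

(** Each of the [n] terms beyond [n] is at most n^(-a), and each of the first [n] terms is at least
    that. This doubling property replaces an explicit asymptotic for the sum. *)
Lemma sum_powRN_doubling a n : 0 <= a -> (0 < n)%N ->
  \sum_(1 <= d < n.*2.+1) d%:R `^ (- a) <=
  2 * \sum_(1 <= d < n.+1) d%:R `^ (- a) :> R.
Proof.
move=> a0 n0; rewrite (@big_cat_nat _ _ _ n.+1) //=; last by lia.
rewrite mulr_natl mulr2n lerD2l.
apply: le_trans (powRN_le_sum n a0).
apply: (@le_trans _ _ (\sum_(n.+1 <= d < n.*2.+1) n%:R `^ (- a))).
  rewrite !big_nat; apply: ler_sum => d dn; apply: ler_powRN_nat => //; lia.
rewrite sumr_const_nat mulr_natl.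
by have -> : (n.*2.+1 - n.+1 = n)%N by lia.
Qed.

End powers.

(** * Divisibility and divisors of products of distinct primes *)

Lemma dvdn_prod_primes (p : nat) (s : seq nat) : prime p -> all prime s ->
  (p %| \prod_(q <- s) q)%N = (p \in s).
Proof.
move=> pp; elim: s => [|q s IH] /=; first by rewrite big_nil dvdn1; case: p pp => [|[|]].
move=> /andP[pq ps]; rewrite big_cons Euclid_dvdM // IH // inE.
by rewrite dvdn_prime2.
Qed.

Lemma prod_primes_gt0 (s : seq nat) : all prime s -> (0 < \prod_(q <- s) q)%N.
Proof.
elim: s => [|q s IH] /=; first by rewrite big_nil.
by move=> /andP[/prime_gt0 q0 /IH]; rewrite big_cons muln_gt0 q0.
Qed.

Lemma prod_primes_dvdn (s : seq nat) (n : nat) : all prime s -> uniq s ->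
  {in s, forall p, p %| n}%N -> (\prod_(q <- s) q %| n)%N.
Proof.
elim: s => [|q s IH] /=; first by rewrite big_nil dvd1n.
move=> /andP[pq ps] /andP[qs us] sn; rewrite big_cons Gauss_dvd.
  rewrite sn ?mem_head //= IH // => p pss; apply: sn.
  by rewrite inE pss orbT.
by rewrite prime_coprime // dvdn_prod_primes.
Qed.

Lemma prime_dvdn_fact (p n : nat) : prime p -> (p %| n`!)%N = (p <= n)%N.
Proof.
move=> pp; apply/idP/idP => [|pn]; last by rewrite dvdn_fact // prime_gt0.
elim: n => [|n IH]; first by rewrite fact0 dvdn1; case: p pp => [|[|]].
rewrite factS Euclid_dvdM // => /orP[/dvdn_leq ->//|/IH].
exact: leqW.
Qed.

Lemma squarefree_dvdn (n m : nat) : (0 < n)%N ->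
  (forall p, prime p -> ~~ (p ^ 2 %| n))%N ->
  (forall p, prime p -> p %| n -> p %| m)%N -> (n %| m)%N.
Proof.
move=> n0 sqf nm; apply/dvdn_partP => // p.
rewrite mem_primes => /and3P[pp _ pn].
rewrite p_part; have := sqf p pp; rewrite pfactor_dvdn // -ltnNge ltnS.
case: (logn p n) => [|[|//]] _; first by rewrite expn0 dvd1n.
by rewrite expn1 nm.
Qed.

(** The divisors of p n split according to whether [p] divides them. *)
Lemma perm_divisors_primeM (p n : nat) : prime p -> (0 < n)%N -> ~~ (p %| n)%N ->
  perm_eq (divisors (p * n)) (divisors n ++ [seq p * d | d <- divisors n]%N).
Proof.
move=> pp n0 pn; have p0 := prime_gt0 pp.
apply: uniq_perm; first exact: divisors_uniq.
  rewrite cat_uniq divisors_uniq map_inj_uniq ?divisors_uniq ?andbT //=; last first.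
    by move=> x y /eqP; rewrite eqn_pmul2l // => /eqP.
  apply/hasPn => _ /mapP[d _ ->] /=.
  rewrite -dvdn_divisors //; apply: contra pn; apply: dvdn_trans.
  exact: dvdn_mulr.
move=> d; rewrite -dvdn_divisors ?muln_gt0 ?p0 // mem_cat -dvdn_divisors //.
apply/idP/orP => [dpn|[dn|/mapP[e + ->]]].
- have [/dvdnP[e de]|pd] := boolP (p %| d)%N.
    right; apply/mapP; exists e; last by rewrite mulnC.
    by move: dpn; rewrite -dvdn_divisors // de mulnC dvdn_pmul2l.
  left; move: dpn; rewrite Gauss_dvdr //.
  by rewrite coprime_sym prime_coprime.
- exact: dvdn_mull.
- by rewrite -dvdn_divisors // dvdn_pmul2l.
Qed.

Lemma sum_divisors_nat (V : nmodType) (G : nat -> V) (n N : nat) : (0 < n < N)%N ->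
  \sum_(d <- divisors n) G d = \sum_(1 <= d < N | (d %| n)%N) G d.
Proof.
move=> /andP[n0 nN]; rewrite -[RHS]big_filter; apply: perm_big.
apply: uniq_perm; [exact: divisors_uniq|by rewrite filter_uniq ?iota_uniq|].
move=> d; rewrite mem_filter mem_index_iota -dvdn_divisors //.
have [dn|//] := boolP (d %| n)%N.
by rewrite (dvdn_gt0 n0 dn) (leq_ltn_trans (dvdn_leq n0 dn) nN).
Qed.

(** * Multiplicative functions supported on squarefree integers *)

Section multiplicative.
Variable R : realType.

(** Each new prime doubles the divisor list and contributes the factor 1 + G p. The function [G] is
    general because both [F] and [F] weighted by a power are needed. *)
Lemma sum_divisors_prod (G : nat -> R) (s : seq nat) : G 1%N = 1 ->
  (forall p d, prime p -> (0 < d)%N -> ~~ (p %| d)%N -> G (p * d)%N = G p * G d) ->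
  all prime s -> uniq s ->
  \sum_(d <- divisors (\prod_(q <- s) q)) G d = \prod_(p <- s) (1 + G p).
Proof.
move=> G1 GM; elim: s => [|p s IH] /=; first by rewrite !big_nil big_seq1.
move=> /andP[pp ps] /andP[pns us].
have s0 := prod_primes_gt0 ps.
have psD : ~~ (p %| \prod_(q <- s) q)%N by rewrite dvdn_prod_primes.
rewrite !big_cons (perm_big _ (perm_divisors_primeM pp s0 psD)) /=.
rewrite big_cat big_map /= -IH // mulrDl mul1r; congr +%R.
rewrite mulr_sumr; apply: eq_big_seq => d; rewrite -dvdn_divisors // => dD.
apply: GM => //; first exact: dvdn_gt0 dD.
by apply: contra psD => pd; apply: dvdn_trans dD.
Qed.

(** What a single outcome of the random function provides. Splitting off one prime at a time
    suffices for every induction below. *)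
Record squarefree_mul (F : nat -> R) : Prop := {
  sfm_one : F 1%N = 1 ;
  sfm_prime : forall p, prime p -> F p = 1 \/ F p = -1 ;
  sfm_mul : forall p d, prime p -> (0 < d)%N -> ~~ (p %| d)%N ->
    F (p * d)%N = F p * F d ;
  sfm_square : forall p d, prime p -> (0 < d)%N -> (p ^ 2 %| d)%N -> F d = 0 }.

Variables (F : nat -> R) (FP : squarefree_mul F).

Lemma sfm_neq0_dvdn (n m : nat) : (0 < n)%N -> F n != 0 ->
  (forall p, prime p -> p %| n -> p %| m)%N -> (n %| m)%N.
Proof.
move=> n0 Fn nm; apply: squarefree_dvdn => // p pp.
by apply: contra Fn => pn; rewrite (sfm_square FP pp).
Qed.

Lemma sfm_norm_le1 (n : nat) : (0 < n)%N -> `|F n| <= 1.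
Proof.
elim/ltn_ind: n => n IH n0.
have [n1|n1] := leqP n 1.
  have -> : n = 1%N by lia.
  by rewrite (sfm_one FP) normr1.
have pp := pdiv_prime n1; have /dvdnP[m nE] := pdiv_dvd n.
set p := pdiv n in pp nE *.
have m0 : (0 < m)%N by move: n0; rewrite nE; case: (m).
have [pm|pm] := boolP (p %| m)%N.
  rewrite (sfm_square FP pp) ?normr0 // nE expnS expn1.
  by rewrite dvdn_pmul2r // prime_gt0.
rewrite nE mulnC (sfm_mul FP) // normrM.
have -> : `|F p| = 1 by case: (sfm_prime FP pp) => ->; rewrite ?normrN normr1.
rewrite mul1r IH // nE -[X in (X < _)%N]muln1 ltn_pmul2l // prime_gt1 //.
Qed.

(** Only divisors of the radical of [n] contribute: any other divisor has a square factor, where [F]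
    vanishes. *)
Lemma sfm_sum_divisors (n : nat) : (0 < n)%N ->
  \sum_(d <- divisors n) F d = \prod_(p <- primes n) (1 + F p).
Proof.
move=> n0; have allp := all_prime_primes n; have un := primes_uniq n.
rewrite -(sum_divisors_prod (sfm_one FP) (sfm_mul FP)) //.
set D := (\prod_(q <- primes n) q)%N.
have D0 : (0 < D)%N by exact: prod_primes_gt0.
have Dn : (D %| n)%N.
  by apply: prod_primes_dvdn => // p; rewrite mem_primes => /and3P[].
have nn : (0 < n < n.+1)%N by rewrite n0 /=.
have DN : (0 < D < n.+1)%N by rewrite D0 ltnS dvdn_leq.
rewrite (sum_divisors_nat _ nn) (sum_divisors_nat _ DN).
rewrite [LHS]big_mkcond [RHS]big_mkcond /= !big_nat; apply: eq_bigr => d /andP[d0 _].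
have [dD|dD] := boolP (d %| D)%N; first by rewrite (dvdn_trans dD Dn).
case: ifP => // dn; apply/eqP; apply: contraR dD => Fd.
apply: sfm_neq0_dvdn => // p pp pd.
by rewrite dvdn_prod_primes // mem_primes pp n0 (dvdn_trans pd dn).
Qed.

Lemma sfm_sum_divisors_ge0 (n : nat) : (0 < n)%N -> 0 <= \sum_(d <- divisors n) F d.
Proof.
move=> n0; rewrite sfm_sum_divisors // big_seq; apply: prodr_ge0 => p.
by rewrite mem_primes => /and3P[/(sfm_prime FP)[] -> _ _]; lra.
Qed.

Lemma sfm_sum_divisors_prime (p : nat) : prime p ->
  \sum_(d <- divisors p) F d = 1 + F p.
Proof.
by move=> pp; rewrite sfm_sum_divisors ?prime_gt0 // primes_prime // big_seq1.
Qed.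

(* The finite Euler product differs from the Dirichlet polynomial of length n
   only by terms beyond n. *)
Lemma sfm_euler_product (del : R) (n : nat) : 0 < del -> (0 < n)%N ->
  \sum_(1 <= d < n.+1) F d * d%:R `^ (- 1 - del) <=
  \prod_(p <- primes n`!) (1 + F p * p%:R `^ (- 1 - del)) +
  n%:R `^ (- del) / del.
Proof.
move=> del0 n0; set G := fun d => F d * d%:R `^ (- 1 - del).
(* The primes dividing n factorial are exactly the primes up to [n]. *)
set s := primes n`!.
have ps : all prime s by exact: all_prime_primes.
have -> : \prod_(p <- s) (1 + F p * p%:R `^ (- 1 - del)) =
    \sum_(d <- divisors (\prod_(q <- s) q)) G d.
  rewrite sum_divisors_prod ?primes_uniq // /G.
    by rewrite (sfm_one FP) powR1 mul1r.
  move=> p d pp d0 pd; rewrite (sfm_mul FP) // natrM powRM ?ler0n //; ring.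
set D := (\prod_(q <- s) q)%N.
have D0 : (0 < D)%N by exact: prod_primes_gt0.
have DN : (0 < D < (n + D).+1)%N by rewrite D0 ltnS leq_addl.
rewrite (sum_divisors_nat _ DN) [X in _ <= X + _](@big_cat_nat _ _ _ n.+1) ?ltnS ?leq_addr //=.
(* A [d] up to [n] with [F d] nonzero is squarefree with all its primes up to [n], hence divides
   [D]. *)
have -> : \sum_(1 <= d < n.+1 | (d %| D)%N) G d = \sum_(1 <= d < n.+1) G d.
  rewrite big_mkcond /= !big_nat; apply: eq_bigr => d /andP[d0 dn].
  case: ifPn => // dD; apply/esym/eqP; rewrite /G mulf_eq0; apply/orP; left.
  apply: contraR dD => Fd; apply: sfm_neq0_dvdn => // p pp pd.
  rewrite dvdn_prod_primes // mem_primes pp fact_gt0 prime_dvdn_fact //=.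
  exact: leq_trans (dvdn_leq d0 pd) _.
rewrite -addrA lerDl -[X in X + _]opprK addrC subr_ge0.
have nD : (0 < n <= n + D)%N by rewrite n0 leq_addr.
apply: le_trans (sum_powR_telescope del0 nD).
rewrite -sumrN big_mkcond /= !big_nat; apply: ler_sum => d /andP[nd _].
have d0 : (0 < d)%N by exact: leq_trans nd.
case: ifP => _; last exact: powR_ge0.
apply: le_trans (ler_norm _) _; rewrite normrN normrM [X in _ * X]ger0_norm ?powR_ge0 //.
by rewrite ler_piMl ?powR_ge0 // sfm_norm_le1.
Qed.

End multiplicative.

(** * Dirichlet series just to the right of 1 *)

(** After summation by parts, the bound [C] is used before [N] and [- K] from [N] on, each against a
    telescoping sum of decrements. When the weights up to [N] are close to 1, the result is close to
    [- K]. *)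
Lemma sum_weight_le (R : realFieldType) (u w : nat -> R) (C K : R) (N n : nat) :
  (0 < N <= n)%N ->
  (forall k, (0 < k)%N -> 0 <= w k) ->
  (forall k, (0 < k)%N -> w k.+1 <= w k) ->
  (forall k, (0 < k)%N -> \sum_(1 <= i < k.+1) u i <= C) ->
  (forall k, (N <= k)%N -> \sum_(1 <= i < k.+1) u i <= - K) ->
  \sum_(1 <= i < n.+1) u i * w i <= C * (w 1%N - w N) - K * w N.
Proof.
move=> /andP[N0 Nn] w0 wd uC uK.
have n0 : (0 < n)%N by exact: leq_trans Nn.
rewrite sum_by_parts // (@big_cat_nat _ _ _ N) //=.
have tele (a b : nat) (D : R) : (a <= b)%N ->
    \sum_(a <= d < b) D * (w d - w d.+1) = D * (w a - w b).
  move=> ab; rewrite -mulr_sumr -[w a - w b]opprB -(telescope_sumr w) // -sumrN.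
  by congr (_ * _); apply: eq_bigr => d _; rewrite opprB.
have -> : C * (w 1%N - w N) - K * w N =
    C * (w 1%N - w N) + (- K) * (w N - w n) + (- K) * w n by ring.
rewrite -!tele //; apply: lerD; first apply: lerD.
- rewrite !big_nat; apply: ler_sum => d /andP[d0 _].
  by rewrite ler_wpM2r ?subr_ge0 ?wd // uC.
- rewrite !big_nat; apply: ler_sum => d /andP[Nd _].
  by rewrite ler_wpM2r ?subr_ge0 ?wd ?uK // (leq_trans N0).
- by rewrite ler_wpM2r ?w0 ?uK.
Qed.

Section euler.
Variables (R : realType) (F : nat -> R) (FP : squarefree_mul F).

(** Supplies the uniform constant for [sum_weight_le]: below [N] the number of terms is a bound, and
    from [N] on the sum is at most 0. *)
Lemma sum_le_of_tail_le (u : nat -> R) (N : nat) (K : R) : 0 <= K ->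
  (forall i, (0 < i)%N -> `|u i| <= 1) ->
  (forall k, (N <= k)%N -> \sum_(1 <= i < k.+1) u i <= - K) ->
  forall k, \sum_(1 <= i < k.+1) u i <= N%:R.
Proof.
move=> K0 u1 uK k; have [Nk|kN] := leqP N k.
  apply: le_trans (uK k Nk) _; rewrite (@le_trans _ _ 0) ?ler0n //; lra.
apply: (@le_trans _ _ (\sum_(1 <= i < k.+1) 1)).
  rewrite !big_nat; apply: ler_sum => i /andP[i0 _].
  exact: le_trans (ler_norm _) (u1 i i0).
by rewrite sumr_const_nat subn1 /= ler_nat ltnW.
Qed.

Lemma powRN_ge1B (del : R) (n : nat) : (0 < n)%N ->
  1 - del * ln n%:R <= n%:R `^ (- del).
Proof.
move=> n0; rewrite /powR pnatr_eq0 gtn_eqF // mulNr.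
exact: expR_ge1Dx.
Qed.

Lemma powRN_nat_lt (del e : R) : 0 < del -> 0 < e ->
  exists N : nat, forall n, (N < n)%N -> n%:R `^ (- del) < e.
Proof.
move=> d0 e0; exists (Num.truncn (expR (- ln e / del))) => n Nn.
have n0 : (0 < n)%N by exact: leq_ltn_trans Nn.
rewrite /powR pnatr_eq0 gtn_eqF //.
rewrite -[ltRHS](@lnK _ e) ?posrE // ltr_expR mulNr ltrNl mulrC -ltr_pdivrMr //.
rewrite -ltr_expR lnK ?posrE ?ltr0n //.
apply: lt_le_trans (truncnS_gt _) _.
by rewrite ler_nat.
Qed.

Lemma norm_div_natr_le1 (x : R) (n : nat) : `|x| <= 1 -> (0 < n)%N ->
  `|x / n%:R| <= 1.
Proof.
move=> x1 n0; rewrite normrM normfV normr_nat ler_pdivrMr ?ltr0n // mul1r.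
by apply: le_trans x1 _; rewrite ler1n.
Qed.

(* Evaluating the Dirichlet series just to the right of 1, where it is an
   Euler product: Abel summation keeps the series away from 0 but forces the
   product to 0. *)
Lemma sfm_log_sum_not_bounded_below (c : R) (N0 : nat) :
  (\sum_(0 <= p < N | prime p) F p / p%:R) @[N --> \oo] --> -oo ->
  0 < c ->
  ~ (forall n, (N0 <= n)%N -> c <= \sum_(1 <= d < n.+1) F d / d%:R).
Proof.
move=> FNy c0.
wlog N0_gt0 : N0 / (0 < N0)%N => [hw Lc|Lc].
  by apply: (hw N0.+1) => // n /ltnW; exact: Lc.
(* Chosen so that exp (- K / 2) < c / 4, because exp (K / 2) >= 1 + K / 2 > 4 / c. *)
pose K := 8 / c; have K0 : 0 < K by rewrite divr_gt0.
pose u i : R := if prime i then F i / i%:R else 0.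
have [N1 N1_gt0 uK] : exists2 N1, (0 < N1)%N &
    forall k, (N1 <= k)%N -> \sum_(1 <= i < k.+1) u i <= - K.
  have [N _ HN] : \forall N \near \oo,
      \sum_(0 <= p < N | prime p) F p / p%:R <= - K by exact: (cvgrNy_le FNy).
  exists N.+1 => // k Nk; have := HN k.+1 (leqW (ltnW Nk)).
  by rewrite big_mkcond big_nat_recl //= add0r big_add1.
have u1 i : (0 < i)%N -> `|u i| <= 1.
  move=> i0; rewrite /u; case: ifP => _; last by rewrite normr0.
  by rewrite norm_div_natr_le1 // sfm_norm_le1.
(* The sign turns the lower bound [c] into an upper bound [- c], as [sum_weight_le] requires. *)
pose v i : R := - (F i / i%:R).
have v1 i : (0 < i)%N -> `|v i| <= 1.
  by move=> i0; rewrite /v normrN norm_div_natr_le1 // sfm_norm_le1.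
have vc k : (N0 <= k)%N -> \sum_(1 <= i < k.+1) v i <= - c.
  by move=> Nk; rewrite sumrN lerN2 Lc.
have uC := sum_le_of_tail_le (ltW K0) u1 uK.
have vC := sum_le_of_tail_le (ltW c0) v1 vc.
(* [sum_weight_le] gives - c + (N0 + c) (1 - w N0), and 1 - w N0 <= del ln N0, so [l0 * del] bounds
   the loss; [l1] does the same for [u]. *)
pose l0 : R := (N0%:R + c) * ln N0%:R.
pose l1 : R := (N1%:R + K) * ln N1%:R.
have l0_ge0 : 0 <= l0.
  by rewrite mulr_ge0 ?addr_ge0 ?ler0n ?(ltW c0) // ln_ge0 // ler1n.
have l1_ge0 : 0 <= l1.
  by rewrite mulr_ge0 ?addr_ge0 ?ler0n ?(ltW K0) // ln_ge0 // ler1n.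
have [del del0 [d0 d1]] : exists2 del : R, 0 < del &
    l0 * del <= c / 2 /\ l1 * del <= K / 2.
  exists (Num.min (c / 2 / (1 + l0)) (K / 2 / (1 + l1))).
    by rewrite lt_min !divr_gt0 //; lra.
  split.
    apply: (@le_trans _ _ (l0 * (c / 2 / (1 + l0)))).
      by rewrite ler_wpM2l // ge_min lexx.
    by rewrite mulrA ler_pdivrMr; nra.
  apply: (@le_trans _ _ (l1 * (K / 2 / (1 + l1)))).
    by rewrite ler_wpM2l // ge_min lexx orbT.
  by rewrite mulrA ler_pdivrMr; nra.
(* With [del] now fixed, going beyond [N2] makes the truncation error n^(-del) / del of the Euler
   product smaller than c / 4. *)
have [N2 HN2] := @powRN_nat_lt del (del * (c / 4)) del0 ltac:(nra).
pose n := (N0 + N1 + N2).+1.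
pose w i : R := i%:R `^ (- del).
have w0 k : (0 < k)%N -> 0 <= w k by move=> _; exact: powR_ge0.
have wd k : (0 < k)%N -> w k.+1 <= w k.
  by move=> k0; apply: ler_powRN_nat; [exact: ltW|rewrite k0 /=].
have w1 : w 1%N = 1 by rewrite /w powR1.
have un := @sum_weight_le R u w N1%:R K N1 n ltac:(lia) w0 wd (fun k _ => uC k) uK.
have vn := @sum_weight_le R v w N0%:R c N0 n ltac:(lia) w0 wd (fun k _ => vC k) vc.
have wN1 := powRN_ge1B del N1_gt0.
have wN0 := powRN_ge1B del N0_gt0.
have usum : \sum_(1 <= i < n.+1) u i * w i <= - (K / 2).
  apply: (le_trans un); rewrite w1.
  have : (N1%:R + K) * (1 - w N1) <= l1 * del.
    rewrite /l1 -mulrA ler_wpM2l ?addr_ge0 ?ler0n ?(ltW K0) //.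
    by move: wN1; rewrite -/(w N1) mulrC; lra.
  by lra.
have vsum : \sum_(1 <= i < n.+1) v i * w i <= - (c / 2).
  apply: (le_trans vn); rewrite w1.
  have : (N0%:R + c) * (1 - w N0) <= l0 * del.
    rewrite /l0 -mulrA ler_wpM2l ?addr_ge0 ?ler0n ?(ltW c0) //.
    by move: wN0; rewrite -/(w N0) mulrC; lra.
  by lra.
have powE i : (0 < i)%N -> i%:R `^ (- 1 - del) = i%:R^-1 * w i.
  move=> i0; rewrite powRD ?pnatr_eq0 ?(gtn_eqF i0) ?implybT //.
  by rewrite powR_inv1 ?ler0n.
have := @sfm_euler_product R F FP del n del0 isT.
have -> : \sum_(1 <= d < n.+1) F d * d%:R `^ (- 1 - del) =
    - \sum_(1 <= i < n.+1) v i * w i.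
  rewrite -sumrN !big_nat; apply: eq_bigr => d /andP[d0' _].
  by rewrite powE // /v mulNr opprK mulrA.
have : \prod_(p <- primes n`!) (1 + F p * p%:R `^ (- 1 - del)) <=
    expR (\sum_(1 <= i < n.+1) u i * w i).
  have -> : \sum_(1 <= i < n.+1) u i * w i =
      \sum_(p <- primes n`!) F p * p%:R `^ (- 1 - del).
    transitivity (\sum_(1 <= i < n.+1 | prime i) F i * i%:R `^ (- 1 - del)).
      rewrite [RHS]big_mkcond /= !big_nat; apply: eq_bigr => i /andP[i0 _].
      rewrite /u; case: ifP => _; last by rewrite mul0r.
      by rewrite powE // mulrA.
    rewrite -big_filter; apply: perm_big; apply: uniq_perm.
    - by rewrite filter_uniq ?iota_uniq.
    - exact: primes_uniq.
    move=> p; rewrite mem_filter mem_index_iota mem_primes fact_gt0 /=.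
    have [pp|//] := boolP (prime p).
    by rewrite prime_gt0 //= ltnS prime_dvdn_fact.
  rewrite expR_sum !big_seq; apply: ler_prod => p.
  rewrite mem_primes => /and3P[pp _ _]; rewrite expR_ge1Dx andbT.
  (* This makes the factor nonnegative, as a factorwise comparison of products requires. *)
  have : `|F p * p%:R `^ (- 1 - del)| <= 1.
    have p0 := prime_gt0 pp.
    rewrite powE // mulrA normrM [`|w p|]ger0_norm ?w0 //.
    apply: mulr_ile1; rewrite ?normr_ge0 ?w0 //.
      by rewrite norm_div_natr_le1 // sfm_norm_le1.
    by rewrite -w1; apply: ler_powRN_nat; [exact: ltW|rewrite p0].
  by rewrite ler_norml => /andP[+ _]; lra.
have : expR (\sum_(1 <= i < n.+1) u i * w i) < c / 4.
  apply: le_lt_trans (_ : expR (- (K / 2)) < _); first by rewrite ler_expR.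
  rewrite expRN invf_plt ?posrE ?expR_gt0 ?divr_gt0 //.
  apply: lt_le_trans (expR_ge1Dx _).
  have -> : (c / 4)^-1 = K / 2 by rewrite /K; field; lra.
  by lra.
have : w n / del < c / 4.
  by rewrite ltr_pdivrMr // mulrC HN2 // /n; lia.
(* The contradiction: c / 2 is at most the Dirichlet polynomial, which is at most product plus
   error, below c / 4 + c / 4. *)
by rewrite -/(w n); lra.
Qed.
End euler.

(** * Sums of floor quotients and the variation of their remainder *)

Section hyperbola.
Variable R : realType.

(* gap X d = d t (1 - t), where t is the fractional part of X / d. *)
Definition gap (X d : nat) : R := (X %% d)%:R * (d%:R - (X %% d)%:R) / d%:R.

Lemma natr_divn_eq (X d : nat) : X%:R = (X %/ d)%:R * d%:R + (X %% d)%:R :> R.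
Proof. by rewrite {1}(divn_eq X d) natrD natrM. Qed.

Lemma natr_modn_bounds (X d : nat) : (0 < d)%N ->
  0 <= (X %% d)%:R :> R /\ (X %% d)%:R + 1 <= d%:R :> R.
Proof. by move=> d0; rewrite ler0n natr1 ler_nat ltn_mod. Qed.

(** With X = q d + r the sum is d q (q - 1) / 2 + r q; eliminating [q] gives the closed form, which
    is checked by induction on [X]. *)
Lemma sum_divn (X d : nat) : (0 < d)%N ->
  \sum_(0 <= n < X) (n %/ d)%:R =
  (X%:R ^+ 2 / d%:R - X%:R + gap X d) / 2 :> R.
Proof.
move=> d0; have dR : 0 < d%:R :> R by rewrite ltr0n.
elim: X => [|X IH].
  by rewrite big_geq // /gap mod0n expr0n /= !mul0r subrr add0r mul0r.
rewrite big_nat_recr //= IH /gap modnS.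
have XE := natr_divn_eq X d; have dvdE := natr_divn_eq X.+1 d.
have -> : (X %/ d)%:R = (X%:R - (X %% d)%:R) / d%:R :> R.
  by rewrite XE; field; lra.
case: ifP => dX.
  have -> : (X %% d)%:R = d%:R - 1 :> R.
    apply/eqP; rewrite eq_sym subr_eq natr1 eqr_nat eqn_leq ltn_mod d0 andbT.
    by rewrite dvdn_leq // -addn1 /dvdn modnDml addn1.
  by rewrite -natr1; field; lra.
by rewrite -!natr1; field; lra.
Qed.

Lemma gap_ge0 (X d : nat) : (0 < d)%N -> 0 <= gap X d.
Proof.
move=> d0; have [r0 rd] := natr_modn_bounds X d0.
by rewrite !mulr_ge0 ?invr_ge0 ?ler0n //; lra.
Qed.

(** The [- 1] makes the gap at [d.+1] at most [d], so that neighbouring gaps share one trivial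
    bound. *)
Lemma gap_le (X d : nat) : (0 < d)%N -> gap X d <= d%:R - 1.
Proof.
move=> d0; have [r0 rd] := natr_modn_bounds X d0.
rewrite /gap ler_pdivrMr ?ltr0n //.
by move: (X %% d)%:R (d%:R) r0 rd => r e *; nra.
Qed.

(* The gap is the maximum over k of these quadratic expressions, attained at
   k = X %/ d. *)
Lemma gap_ge (X d k : nat) : (0 < d)%N ->
  (X%:R - k%:R * d%:R) * ((k%:R + 1) * d%:R - X%:R) / d%:R <= gap X d.
Proof.
move=> d0; have [r0 rd] := natr_modn_bounds X d0.
have dR : 0 < d%:R :> R by rewrite ltr0n.
have XE := natr_divn_eq X d.
have [kq|qk|kq] := ltngtP k (X %/ d).
- apply: le_trans (gap_ge0 _ d0); rewrite pmulr_lle0 ?invr_gt0 //.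
  have : k%:R + 1 <= (X %/ d)%:R :> R by rewrite natr1 ler_nat.
  rewrite XE; move: (k%:R) (X %/ d)%:R (X %% d)%:R (d%:R) r0 rd dR => *.
  by apply: mulr_ge0_le0; nra.
- apply: le_trans (gap_ge0 _ d0); rewrite pmulr_lle0 ?invr_gt0 //.
  have : (X %/ d)%:R + 1 <= k%:R :> R by rewrite natr1 ler_nat.
  rewrite XE; move: (k%:R) (X %/ d)%:R (X %% d)%:R (d%:R) r0 rd dR => *.
  by apply: mulr_le0_ge0; nra.
- rewrite kq /gap ler_pM2r ?invr_gt0 // XE.
  by move: (X %/ d)%:R (X %% d)%:R (d%:R) => q r e; lra.
Qed.

(** Here X = q e + r: the quotient of [e] is kept in the quadratic expression for the modulus
    [e + 1], and [q <= e] limits the loss. *)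
Let gap_step_up (q r e : R) : 0 <= r -> r + 1 <= e -> 1 <= q -> q <= e ->
  r * (e - r) / e - 4 * (q * e + r) / e <=
  (q * e + r - q * (e + 1)) * ((q + 1) * (e + 1) - (q * e + r)) / (e + 1).
Proof.
move=> r0 re q1 qe; have e0 : 0 < e by lra.
rewrite ler_pdivlMr; last by lra.
rewrite -mulrBl mulrAC ler_pdivrMr // -subr_ge0.
(* Nonnegative products from which [nra] assembles the inequality with cleared denominators. *)
have p1 : 0 <= e * q * (e - q + r) by rewrite !mulr_ge0 //; lra.
have p2 : 0 <= e * e - r * (e - r) by nra.
have p3 : 0 <= e * e * (q - 1) by rewrite !mulr_ge0 //; lra.
have p4 : 0 <= e * r * (1 + q) by rewrite !mulr_ge0 //; lra.
have p5 : 0 <= r * (e + 1) by rewrite !mulr_ge0 //; lra.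
have p6 : 0 <= e * q * (e + 1) by rewrite !mulr_ge0 //; lra.
have p7 : 0 <= e * q by rewrite !mulr_ge0 //; lra.
nra.
Qed.

(** The mirror image: X = q (e + 1) + r, and the quotient of [e + 1] is used at the modulus [e]. *)
Let gap_step_down (q r e : R) : 0 <= r -> r <= e -> 0 <= q -> q <= e -> 1 <= e ->
  r * (e + 1 - r) / (e + 1) - 4 * (q * (e + 1) + r) / e <=
  (q * (e + 1) + r - q * e) * ((q + 1) * e - (q * (e + 1) + r)) / e.
Proof.
move=> r0 re q0 qe e1; have e0 : 0 < e by lra.
rewrite lerBlDr -mulrDl ler_pdivrMr; last by lra.
rewrite [leRHS]mulrAC ler_pdivlMr // -subr_ge0.
have p1 : 0 <= (e + 1) * q * (e - q) by rewrite !mulr_ge0 //; lra.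
have p2 : 0 <= (e + 1) * q * (e - r) by rewrite !mulr_ge0 //; lra.
have p3 : 0 <= r * (e - r) by rewrite !mulr_ge0 //; lra.
have p4 : 0 <= r * (e + 1) by rewrite !mulr_ge0 //; lra.
have p5 : 0 <= q * e * (e + 1) by rewrite !mulr_ge0 //; lra.
have p6 : 0 <= q * (e + 1) by rewrite !mulr_ge0 //; lra.
nra.
Qed.

(** By [gap_ge], the quotient at one modulus gives a lower bound for the gap at its neighbour, with
    small loss if that quotient is at most [d]. Otherwise X >= d^2, and the trivial bound [d] on
    both gaps is already below 4 X / d. *)
Lemma gap_variation (X d : nat) : (0 < d <= X)%N ->
  `|gap X d - gap X d.+1| <= 4 * X%:R / d%:R.
Proof.
move=> /andP[d0 dX].
have dR : 1 <= d%:R :> R by rewrite ler1n.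
have gap_small (q : R) : d%:R <= q -> q * d%:R <= X%:R -> d%:R <= 4 * X%:R / d%:R :> R.
  by move=> dq qX; rewrite ler_pdivlMr; nra.
rewrite ler_norml; apply/andP; split.
- have [r0 rd] := natr_modn_bounds X (ltn0Sn d).
  have XE := natr_divn_eq X d.+1.
  have g1 := gap_le X (ltn0Sn d); have g2 := gap_ge0 X d0.
  have := gap_ge X (X %/ d.+1) d0.
  rewrite -natr1 in rd XE g1.
  have q0 : 0 <= (X %/ d.+1)%:R :> R by rewrite ler0n.
  have [qd|/ltW dq] := leP (X %/ d.+1)%:R (d%:R : R).
    move=> g3; suff : gap X d.+1 - 4 * X%:R / d%:R <= gap X d by lra.
    apply: le_trans g3; rewrite /gap -natr1 XE; apply: gap_step_down => //; lra.
  by move=> _; have := gap_small _ dq ltac:(nra); lra.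
- have [r0 rd] := natr_modn_bounds X d0.
  have XE := natr_divn_eq X d.
  have g1 := gap_le X d0; have g2 := gap_ge0 X (ltn0Sn d).
  have := gap_ge X (X %/ d) (ltn0Sn d); rewrite -natr1.
  have q1 : 1 <= (X %/ d)%:R :> R by rewrite ler1n divn_gt0.
  have [qd|/ltW dq] := leP (X %/ d)%:R (d%:R : R).
    move=> g3; suff : gap X d - 4 * X%:R / d%:R <= gap X d.+1 by lra.
    by apply: le_trans g3; rewrite /gap XE; apply: gap_step_up.
  by move=> _; have := gap_small _ dq ltac:(nra); lra.
Qed.

End hyperbola.

(** * Estimates for a fixed outcome *)

Section deterministic.
Variables (R : realType) (F : nat -> R) (FP : squarefree_mul F) (al C : R).
Hypothesis al0 : 0 < al.
Hypothesis F_Ny : (\sum_(0 <= p < N | prime p) F p / p%:R) @[N --> \oo] --> -oo.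

Let M n := \sum_(1 <= d < n.+1) F d.
Let L n := \sum_(1 <= d < n.+1) F d / d%:R.
(** For al < 1 this has the order n^(1 - al). As a sum it can be compared directly with [A] in a
    summation by parts. *)
Let V n : R := \sum_(1 <= d < n.+1) d%:R `^ (- al).
Let A n := \sum_(1 <= m < n.+1) \sum_(d <- divisors m) F d.

Hypothesis M_bound : forall n, (0 < n)%N -> `|M n| <= C * (n%:R * n%:R `^ (- al)).

Lemma bound_ge0 : 0 <= C.
Proof.
by have := le_trans (normr_ge0 _) (@M_bound 1%N isT); rewrite powR1 !mulr1.
Qed.

(** Summation by parts expresses [L] through [M]. The two boundary terms contribute 2 to the
    constant and the tail contributes 1 + 1 / al. *)
Lemma log_sum_variation X Y : (0 < X <= Y)%N ->
  L X - L Y <= C * (3 + al^-1) * X%:R `^ (- al).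
Proof.
move=> /andP[X0 XY]; have C0 := bound_ge0.
have Y0 : (0 < Y)%N by exact: leq_trans XY.
have Mdiv n : (0 < n)%N -> `|M n / n%:R| <= C * n%:R `^ (- al).
  move=> n0; rewrite normrM normfV normr_nat ler_pdivrMr ?ltr0n //.
  by rewrite -mulrA [X in C * X]mulrC M_bound.
have LE n : (0 < n)%N -> L n =
    \sum_(1 <= d < n) M d * (d%:R^-1 - d.+1%:R^-1) + M n / n%:R.
  by move=> n0; rewrite /L (sum_by_parts F (fun d => d%:R^-1)).
have hXY : Y%:R `^ (- al) <= X%:R `^ (- al) :> R.
  by apply: ler_powRN_nat; [exact: ltW|rewrite X0].
have tail : - \sum_(X <= d < Y) M d * (d%:R^-1 - d.+1%:R^-1) <=
    C * ((1 + al^-1) * X%:R `^ (- al)).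
  apply: (@le_trans _ _ (\sum_(X <= d < Y) C * d%:R `^ (- 1 - al))).
    rewrite -sumrN !big_nat; apply: ler_sum => d /andP[Xd _].
    have d0 : (0 < d)%N by exact: leq_trans Xd.
    have dR : 0 < d%:R :> R by rewrite ltr0n.
    have -> : d%:R^-1 - d.+1%:R^-1 = d%:R^-1 * d.+1%:R^-1 :> R.
      by rewrite -natr1; field; lra.
    have -> : d%:R `^ (- 1 - al) = d%:R^-1 * d%:R `^ (- al) :> R.
      by rewrite powRD ?(gt_eqF dR) ?implybT // powR_inv1 ?ler0n.
    rewrite mulrA; apply: le_trans (ler_norm _) _.
    rewrite normrN normrM; set t := `|d.+1%:R^-1|.
    have tE : t <= d%:R^-1.
      by rewrite /t ger0_norm ?invr_ge0 ?ler0n // lef_pV2 ?posrE ?ltr0n // ler_nat.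
    rewrite mulrCA [leRHS]mulrC; apply: ler_pM; rewrite ?normr_ge0 //.
    exact: Mdiv.
  rewrite -mulr_sumr ler_wpM2l //.
  move: XY; rewrite leq_eqVlt => /predU1P[<-|XY].
    by rewrite big_geq // mulr_ge0 ?powR_ge0 // addr_ge0 // invr_ge0 ltW.
  (* The term d = X is at most X^(-al) since X >= 1; the remaining ones telescope to at most X^(-al)
     / al. *)
  rewrite big_ltn //= mulrDl mul1r; apply: lerD.
    have XR : 1 <= X%:R :> R by rewrite ler1n.
    by apply: ler_powR => //; lra.
  case: Y XY {Y0 hXY} => // Y; rewrite ltnS => XY.
  by rewrite mulrC sum_powR_telescope // X0.
have hX := Mdiv X X0; have hY := Mdiv Y Y0.
rewrite !LE // [X in _ - (X + _)](@big_cat_nat _ _ _ X) //=.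
move: hX hY; rewrite !ler_norml => /andP[_ hX] /andP[hY _].
have hC : C * Y%:R `^ (- al) <= C * X%:R `^ (- al) by rewrite ler_wpM2l.
by lra.
Qed.

(** If [L X] exceeded this bound, [log_sum_variation] would keep [L n] above a positive constant for
    all n >= X, which the Euler product excludes. *)
Lemma log_sum_le X : (0 < X)%N -> L X <= C * (3 + al^-1) * X%:R `^ (- al).
Proof.
move=> X0; rewrite leNgt; apply/negP => lt.
have c0 : 0 < L X - C * (3 + al^-1) * X%:R `^ (- al) by rewrite subr_gt0.
apply: (@sfm_log_sum_not_bounded_below R F FP _ X F_Ny c0) => n Xn.
have := @log_sum_variation X n; rewrite X0 Xn => /(_ isT); rewrite -/(L n); lra.
Qed.

Lemma divisor_sum_eq n : A n = \sum_(1 <= d < n.+1) F d * (n %/ d)%:R.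
Proof.
elim: n => [|n IH]; first by rewrite /A !big_geq.
rewrite /A big_nat_recr //= -/(A n) IH.
have nn : (0 < n.+1 < n.+2)%N by rewrite /=.
rewrite (sum_divisors_nat F nn) [RHS]big_nat_recr //=.
have -> : \sum_(1 <= d < n.+1) F d * (n.+1 %/ d)%:R =
    \sum_(1 <= d < n.+1) F d * (n %/ d)%:R +
    \sum_(1 <= d < n.+1) (if (d %| n.+1)%N then F d else 0).
  rewrite -big_split !big_nat; apply: eq_bigr => d /andP[d0 _] /=.
  by rewrite divnS // natrD mulrDr addrC; case: (_ %| _)%N; rewrite ?mulr1 ?mulr0.
rewrite divnn /= mulr1 -addrA; congr (_ + _).
by rewrite big_mkcond big_nat_recr //= dvdnn.
Qed.

(* Averaging A smooths the remainders X mod d: the gap term has small variation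
   in d, whereas the error of A X itself would not be controlled by the
   cancellation in M. *)
Lemma sum_divisor_sum X :
  \sum_(0 <= n < X) A n =
  (X%:R ^+ 2 * L X - X%:R * M X + \sum_(1 <= d < X.+1) F d * gap R X d) / 2.
Proof.
(* Extending the range of [d] to [X] adds only zero quotients and makes it independent of [n], so
   the sums can be exchanged. *)
transitivity (\sum_(0 <= n < X) \sum_(1 <= d < X.+1) F d * (n %/ d)%:R).
  rewrite !big_nat; apply: eq_bigr => n nX; rewrite divisor_sum_eq.
  rewrite [RHS](@big_cat_nat _ _ _ n.+1) //=; last by lia.
  rewrite -[LHS]addr0; congr +%R; apply/esym.
  rewrite big_nat; apply: big1 => d /andP[nd _].
  by rewrite divn_small // mulr0.
rewrite exchange_big_nat /= /L /M !mulr_sumr -sumrN -!big_split mulr_suml /=.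
rewrite !big_nat; apply: eq_bigr => d /andP[d0 _].
rewrite -mulr_sumr sum_divn //; field.
by rewrite pnatr_eq0 -lt0n.
Qed.

Lemma divisor_sum_ge0 n : 0 <= A n.
Proof.
rewrite /A big_nat; apply: sumr_ge0 => m /andP[m0 _].
exact: sfm_sum_divisors_ge0.
Qed.

Lemma divisor_sum_le m n : (m <= n)%N -> A m <= A n.
Proof.
move=> mn; rewrite /A (@big_cat_nat _ _ _ m.+1 1 n.+1) //= lerDl.
rewrite big_nat; apply: sumr_ge0 => d /andP[md _].
by apply: sfm_sum_divisors_ge0 => //; apply: leq_trans md.
Qed.

(** The summands account in order for [L], [M] and the gap in [sum_divisor_sum]. *)
Let D := C * (3 + al^-1) + C + 4 * C.

Let D0 : 0 <= D.
Proof.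
have C0 := bound_ge0; have i0 : 0 <= al^-1 by rewrite invr_ge0 ltW.
by rewrite /D; nra.
Qed.

Lemma sum_divisor_sum_le X : (0 < X)%N ->
  \sum_(0 <= n < X) A n <= D / 2 * (X%:R * V X).
Proof.
move=> X0; rewrite sum_divisor_sum; have C0 := bound_ge0.
have VX : X%:R * X%:R `^ (- al) <= V X by exact: powRN_le_sum (ltW al0).
have XR : 0 <= X%:R :> R by rewrite ler0n.
have t1 : X%:R ^+ 2 * L X <= C * (3 + al^-1) * (X%:R * V X).
  apply: (@le_trans _ _ (X%:R ^+ 2 * (C * (3 + al^-1) * X%:R `^ (- al)))).
    by rewrite ler_wpM2l ?exprn_ge0 // log_sum_le.
  rewrite mulrCA ler_wpM2l //; first by rewrite mulr_ge0 // addr_ge0 // invr_ge0 ltW.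
  by rewrite expr2 -mulrA ler_wpM2l.
have t2 : - (X%:R * M X) <= C * (X%:R * V X).
  rewrite -mulrN mulrCA ler_wpM2l //.
  apply: le_trans (ler_norm _) _; rewrite normrN.
  by apply: le_trans (M_bound X0) _; rewrite ler_wpM2l.
have t3 : \sum_(1 <= d < X.+1) F d * gap R X d <= 4 * C * (X%:R * V X).
  (* The boundary term vanishes because [X] leaves remainder 0 modulo itself. *)
  rewrite sum_by_parts // [gap R X X]/gap modnn !mul0r mulr0 addr0.
  apply: (@le_trans _ _ (\sum_(1 <= d < X) 4 * C * X%:R * d%:R `^ (- al))).
    rewrite !big_nat; apply: ler_sum => d /andP[d0 dX].
    have dR : 0 < d%:R :> R by rewrite ltr0n.
    apply: le_trans (ler_norm _) _; rewrite normrM.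
    apply: (@le_trans _ _
        (C * (d%:R * d%:R `^ (- al)) * (4 * X%:R / d%:R))).
      by apply: ler_pM => //; [exact: M_bound|rewrite gap_variation // d0 ltnW].
    by rewrite le_eqVlt; apply/orP; left; apply/eqP; field; lra.
  rewrite -mulr_sumr -mulrA ler_wpM2l ?mulr_ge0 // ler_wpM2l //.
  by rewrite /V big_nat_recr //= lerDl powR_ge0.
by rewrite /D; lra.
Qed.

(** Monotonicity removes the averaging: X A(X) is at most the sum of [A] over [X, 2X), and doubling
    bounds V(2X) by 2 V(X). *)
Lemma divisor_sum_bound X : (0 < X)%N -> A X <= 2 * D * V X.
Proof.
move=> X0; have XR : 0 < X%:R :> R by rewrite ltr0n.
rewrite -(ler_pM2l XR).
apply: (@le_trans _ _ (\sum_(0 <= n < X.*2) A n)).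
  rewrite (@big_cat_nat _ _ _ X) //=; last by lia.
  rewrite -[leLHS]add0r; apply: lerD.
    by apply: sumr_ge0 => n _; exact: divisor_sum_ge0.
  have -> : X%:R * A X = \sum_(X <= n < X.*2) A X.
    by rewrite sumr_const_nat -addnn addnK mulr_natl.
  by rewrite !big_nat; apply: ler_sum => n /andP[Xn _]; exact: divisor_sum_le.
apply: le_trans (sum_divisor_sum_le _) _; first by lia.
have := sum_powRN_doubling (ltW al0) X0; rewrite -/(V X) -/(V X.*2) => V2.
have -> : X.*2%:R = 2 * X%:R :> R by rewrite -mul2n natrM.
have := ler_wpM2l (mulr_ge0 D0 (ltW XR)) V2; lra.
Qed.

(** The prime terms are part of a nonnegative sum over all integers. Summation by parts replaces the
    divisor sums by 2 D n^(-al), leaving the convergent series of n^(-1-eps). *)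
Lemma prime_sum_bound eps : al < 1 -> 0 < eps -> exists B : R, forall N : nat,
  \sum_(0 <= p < N | prime p) (1 + F p) / p%:R `^ (1 - al + eps) <= B.
Proof.
move=> al1 eps0; exists (2 * D * (1 + eps^-1)) => N.
have s0 : 0 <= 1 - al + eps by lra.
pose w i : R := i%:R `^ (- (1 - al + eps)).
case: N => [|N].
  by rewrite big_geq // mulr_ge0 ?mulr_ge0 // addr_ge0 // invr_ge0 ltW.
apply: (@le_trans _ _ (\sum_(1 <= n < N.+1) (\sum_(d <- divisors n) F d) * w n)).
  rewrite big_mkcond big_nat_recl //= add0r [leRHS]big_add1 /=.
  apply: ler_sum => n _; rewrite /w powRN; case: ifP => pn.
    by rewrite sfm_sum_divisors_prime.
  by rewrite mulr_ge0 ?invr_ge0 ?powR_ge0 // sfm_sum_divisors_ge0.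
apply: (@le_trans _ _ (\sum_(1 <= n < N.+1) (2 * D * n%:R `^ (- al)) * w n)).
  apply: ler_sum_by_parts => [k /andP[k0 _]|k _|k k0].
  - by rewrite -/(A k) -mulr_sumr; exact: divisor_sum_bound.
  - exact: powR_ge0.
  - by apply: ler_powRN_nat => //; rewrite k0 /=.
have -> : \sum_(1 <= n < N.+1) 2 * D * n%:R `^ (- al) * w n =
    2 * D * \sum_(1 <= n < N.+1) n%:R `^ (- 1 - eps).
  rewrite mulr_sumr !big_nat; apply: eq_bigr => n /andP[n0 _].
  rewrite -mulrA -powRD ?pnatr_eq0 ?(gtn_eqF n0) ?implybT //.
  by congr (_ * _ `^ _); lra.
rewrite ler_wpM2l ?mulr_ge0 //.
case: N => [|N]; first by rewrite big_geq // addr_ge0 // invr_ge0 ltW.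
rewrite big_ltn // powR1 lerD2l.
have := @sum_powR_telescope R eps 1 N.+1 eps0 isT.
by rewrite powR1 mul1r.
Qed.

End deterministic.

(** * From the random function to its outcomes *)

Lemma perm_primes_primeM (p d : nat) : prime p -> (0 < d)%N -> ~~ (p %| d)%N ->
  perm_eq (primes (p * d)) (p :: primes d).
Proof.
move=> pp d0 pd; apply: uniq_perm; first exact: primes_uniq.
  by rewrite /= primes_uniq mem_primes (negbTE pd) !andbF.
by move=> q; rewrite primesM ?(prime_gt0 pp) // (primes_prime pp) !inE.
Qed.

Section random.
Context d (T : measurableType d) (R : realType) (P : probability T R).
Variables (f : nat -> {RV P >-> R}) (w : T).
Hypothesis fP : random_multiplicative f.

(** The absolute value removes the sign of [moebius]; the formula also covers n = 1, where the
    product is empty. *)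
Let rmfE (n : nat) : (0 < n)%N -> f n w =
  if has (fun p => p ^ 2 %| n)%N (primes n) then 0 else \prod_(p <- primes n) f p w.
Proof.
case: n => [//|[_|n _]]; first by rewrite rmf_one //= big_nil.
rewrite rmf_mul // /moebius; case: ifP => _; first by rewrite normr0 mul0r.
by rewrite normrX normrN1 expr1n mul1r.
Qed.

Lemma random_multiplicative_sfm : squarefree_mul (fun n => f n w).
Proof.
split.
- exact: rmf_one.
- by move=> p pp; exact: rmf_prime.
- move=> p e pp e0 pe; have p0 := prime_gt0 pp.
  have perm := perm_primes_primeM pp e0 pe.
  rewrite (rmfE e0) rmfE ?muln_gt0 ?p0 // (perm_has _ perm) (perm_big _ perm) /=.
  rewrite big_cons expnS expn1 dvdn_pmul2l // (negbTE pe) /=.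
  (* A prime [q] dividing [e] differs from [p], so its square is coprime to [p]. *)
  rewrite (@eq_in_has _ _ (fun q => q ^ 2 %| e)%N).
    by case: ifP => _; rewrite ?mulr0.
  move=> q; rewrite mem_primes => /and3P[pq _ qe].
  rewrite Gauss_dvdr // coprimeXl // prime_coprime // dvdn_prime2 //.
  by apply: contra pe => /eqP <-.
- move=> p e pp e0 pe; rewrite rmfE // ifT //; apply/hasP; exists p => //.
  by rewrite mem_primes pp e0 (dvdn_trans _ pe) // expnS dvdn_mulr.
Qed.

(** The little-o gives the constant 1 beyond some [x0]. Below [N], an integer exceeding [x0], the
    trivial bound n <= N is enough because n^(1 - al) >= 1, so [N] serves as the constant
    throughout. *)
Lemma summatory_bound (al : R) : al <= 1 ->
  summatory f w =o_ +oo (fun x : R => x `^ (1 - al)) ->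
  exists C : R, forall n, (0 < n)%N ->
    `|\sum_(1 <= i < n.+1) f i w| <= C * (n%:R * n%:R `^ (- al)).
Proof.
move=> al1 /eqoP /(_ 1 ltr01) [x0 [_ Hx]].
pose N := (Num.truncn x0).+1; exists (N%:R) => n n0.
have NR : 1 <= N%:R :> R by rewrite ler1n.
have nE : n%:R * n%:R `^ (- al) = n%:R `^ (1 - al) :> R.
  rewrite powRD ?pnatr_eq0 ?(gtn_eqF n0) ?implybT //.
  by rewrite powRr1 ?ler0n.
have n1 : 1 <= n%:R `^ (1 - al) :> R.
  rewrite -[leLHS](powRr0 (n%:R : R)); apply: ler_powR; first by rewrite ler1n.
  by rewrite subr_ge0.
rewrite nE; have [Nn|nN] := leqP N n.
  have := Hx n%:R; rewrite /summatory natrK => /(_ _)/le_trans; apply.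
    by apply: lt_le_trans (truncnS_gt x0) _; rewrite ler_nat.
  rewrite mul1r ger0_norm ?powR_ge0 // ler_peMl //; lra.
apply: (@le_trans _ _ n%:R).
  apply: le_trans (ler_norm_sum _ _ _) _.
  apply: (@le_trans _ _ (\sum_(1 <= i < n.+1) 1)).
    rewrite !big_nat; apply: ler_sum => i /andP[i0 _].
    exact: (sfm_norm_le1 random_multiplicative_sfm).
  by rewrite sumr_const_nat subn1.
apply: (@le_trans _ _ N%:R); first by rewrite ler_nat ltnW.
by rewrite ler_peMr // ler0n.
Qed.

End random.

Theorem theorem1p4 (d : measure_display) (T : measurableType d) (R : realType)
    (P : probability T R) (f : nat -> {RV P >-> R}) (alpha : R) :
  random_multiplicative f -> strongly_biased f ->
  0 < alpha -> alpha < 1 / 2 ->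
  {ae P, forall w,
    summatory f w =o_ +oo (fun x : R => x `^ (1 - alpha))} ->
  {ae P, forall w, forall eps : R, 0 < eps ->
    cvg ((\sum_(0 <= p < N | prime p)
            (1 + f p w) / p%:R `^ (1 - alpha + eps)) @[N --> \oo])}.
Proof.
move=> fP [_ fNy] al0 al12 fo; have al1 : alpha < 1 by lra.
(* The almost sure event is fixed before [eps], so one exceptional set serves every [eps]. *)
move: fNy fo; apply: filterS2 => w fNy fo eps eps0.
have FP := random_multiplicative_sfm w fP.
have [C MC] := summatory_bound fP (ltW al1) fo.
have [B HB] := prime_sum_bound FP al0 fNy MC al1 eps0.
have term_ge0 p : prime p -> 0 <= (1 + f p w) / p%:R `^ (1 - alpha + eps).
  by move=> pp; rewrite divr_ge0 ?powR_ge0 //; case: (sfm_prime FP pp) => ->; lra.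
apply: nondecreasing_is_cvgn.
  move=> m n mn; rewrite [leRHS](@big_cat_nat _ _ _ m) //= lerDl.
  exact: sumr_ge0.
by exists B => _ [N _ <-].
Qed.
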